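(* Let $\Phi_1$ be a growth function such that $\Phi_1^{-1}$ is log-convex up to a constant $C_1\ge 1$, and let $\Phi_2$ be a growth function such that $\Phi_2^{-1}$ is log-concave up to a constant $C_2\ge 1$. Then the set $$\mathcal{E}=\left\{(\alpha,\beta)\in\mathbb{R}^2 \;\middle|\; \alpha,\beta\ge -1,\ \exists\, C,K>0 \text{ such that } \Phi_1^{-1}(t^{2+\alpha})\le C\,\Phi_2^{-1}(K t^{2+\beta}) \text{ for all } t>0\right\}$$ is a convex subset of $\mathbb{R}^2$.
   Context: A growth function is an increasing function $\Phi:[0,\infty)\to[0,\infty)$ with $\Phi(0)=0$ and $\Phi(t)\to\infty$ as $t\to\infty$. The growth functions whose inverse $\Phi^{-1}$ is used are assumed to be bijections of $[0,\infty)$, i.e. strictly increasing and continuous, so $\Phi^{-1}$ is again a growth function. A growth function $\Phi$ is log-convex up to a constant $C\ge 1$ (written $\Phi\in\Delta_{\log}^-$) if $\Phi(u^\theta v^{1-\theta})\le C^{\theta(1-\theta)}\Phi(u)^\theta\Phi(v)^{1-\theta}$ for all $u,v>0$ and $\theta\in[0,1]$. A growth function $\Phi$ is log-concave up to a constant $C\ge 1$ (written $\Phi\in\Delta_{\log}^+$) if $\Phi(C^{\theta(1-\theta)}u^\theta v^{1-\theta})\ge \Phi(u)^\theta\Phi(v)^{1-\theta}$ for all $u,v>0$ and $\theta\in[0,1]$. *)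

(* Defs.v *)
From HB Require Import structures.
From mathcomp Require Import all_boot all_order all_algebra.
From mathcomp Require Import all_classical all_reals all_analysis.

Set Implicit Arguments.
Unset Strict Implicit.
Unset Printing Implicit Defensive.

Import Order.TTheory GRing.Theory Num.Theory.
Import numFieldNormedType.Exports.

Local Open Scope classical_set_scope.
Local Open Scope ring_scope.

Section GrowthFunctions.
Context {R : realType}.
Implicit Types (Phi : R -> R) (C : R).

(* A function [0, oo) -> [0, oo) is represented by a total function R -> R
   whose values outside [0, oo) are irrelevant.  "Increasing" is read in the
   wide sense; strictness comes from [growth_bijection]. *)
Definition growth_function Phi : Prop :=
  [/\ set_fun `[0, +oo[ `[0, +oo[ Phi,
      {in `[0, +oo[ &, {homo Phi : s t / s <= t}},
      Phi 0 = 0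
    & Phi t @[t --> +oo] --> +oo].

(* Equivalently, a strictly increasing and continuous growth function. *)
Definition growth_bijection Phi : Prop :=
  growth_function Phi /\ set_bij `[0, +oo[ `[0, +oo[ Phi.

(* For a growth bijection this is the two-sided inverse on [0, oo). *)
Definition growth_inv Phi : R -> R := 'pinv_(fun=> 0) `[0, +oo[ Phi.

(* The convention 0 `^ 0 = 1 only matters for growth functions that vanish at
   some positive point. *)
Definition log_convex_upto C Phi : Prop :=
  forall u v theta : R, 0 < u -> 0 < v -> 0 <= theta <= 1 ->
    Phi (u `^ theta * v `^ (1 - theta)) <=
      C `^ (theta * (1 - theta)) * Phi u `^ theta * Phi v `^ (1 - theta).

Definition log_concave_upto C Phi : Prop :=
  forall u v theta : R, 0 < u -> 0 < v -> 0 <= theta <= 1 ->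
    Phi u `^ theta * Phi v `^ (1 - theta) <=
      Phi (C `^ (theta * (1 - theta)) * u `^ theta * v `^ (1 - theta)).

Definition exponent_set Phi1 Phi2 : set (R^o * R^o) :=
  [set ab | [/\ -1 <= ab.1, -1 <= ab.2
    & exists C K : R, [/\ 0 < C, 0 < K
      & forall t : R, 0 < t ->
          growth_inv Phi1 (t `^ (2 + ab.1)) <=
            C * growth_inv Phi2 (K * t `^ (2 + ab.2))]]].

End GrowthFunctions.

(* Main.v *)
Require Import Defs.
From mathcomp Require Import all_boot all_order all_algebra.
From mathcomp Require Import all_classical all_reals all_analysis.
From mathcomp Require Import ring.
Import Order.TTheory GRing.Theory Num.Theory.
Import numFieldNormedType.Exports.
Local Open Scope classical_set_scope.
Local Open Scope ring_scope.

(** Write [Psi1], [Psi2] for the inverses of [Phi1], [Phi2].  A pair of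
    exponents [(a, b)] is admissible when [t `^ (2 + a)] and [t `^ (2 + b)],
    which depend log-affinely on [(a, b)], satisfy
    [Psi1 (t `^ (2 + a)) <= C * Psi2 (K * t `^ (2 + b))].  Take two admissible
    pairs and the weights [l], [1 - l]: the powers of [t] attached to the convex
    combination are the weighted geometric means of the given ones
    ([powR_affine]).  Log-convexity of [Psi1] bounds its value at the mean of
    two points by the mean of its values; the two given inequalities, raised to
    the powers [l] and [1 - l] and multiplied, replace [Psi1] by [Psi2]
    ([ler_geometric_mean]); log-concavity of [Psi2] takes the mean back inside
    its argument.  The constants collected on the way, [C1 `^ (l * (1 - l))]
    outside and [C2 `^ (l * (1 - l))] inside, do not depend on [t], so they are
    absorbed into the new [C] and [K]. *)

(** Raising [growth_inv Phi x <= ...] to a power preserves the inequality only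
    between nonnegative numbers. *)
Lemma growth_inv_ge0 (R : realType) (Phi : R -> R) (x : R) :
  growth_bijection Phi -> 0 <= x -> 0 <= growth_inv Phi x.
Proof.
move=> [_ bijPhi] x0.
have [inv_fun _ _] := bijpinv_bij (fun=> 0) bijPhi.
have : growth_inv Phi x \in `[0, +oo[.
  by apply: inv_fun => /=; rewrite in_itv /= x0.
by rewrite in_itv /= andbT.
Qed.

(** An affine function of the exponent turns convex combinations into weighted
    geometric means; the weights sum to one, so the offset [c] is preserved. *)
Lemma powR_affine {R : realType} {t : R} (c a b l : R) : 0 < t ->
  t `^ (c + (l * a + (1 - l) * b)) =
  (t `^ (c + a)) `^ l * (t `^ (c + b)) `^ (1 - l).
Proof.
move=> t0; rewrite -!powRrM -powRD; last by rewrite (gt_eqF t0) implybT.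
by congr powR; ring.
Qed.

Lemma ler_geometric_mean (R : realType) (x y x' y' l : R) :
  0 <= l <= 1 -> 0 <= x <= x' -> 0 <= y <= y' ->
  x `^ l * y `^ (1 - l) <= x' `^ l * y' `^ (1 - l).
Proof.
move=> /andP[l0 l1] /andP[x0 xx'] /andP[y0 yy'].
apply: ler_pM; rewrite ?powR_ge0 //.
- by apply: ge0_ler_powR; rewrite ?nnegrE // (le_trans x0).
- by apply: ge0_ler_powR; rewrite ?nnegrE ?subr_ge0 // (le_trans y0).
Qed.

Lemma geometric_meanM {R : realType} {x y x' y' : R} (l : R) :
  0 <= x -> 0 <= x' -> 0 <= y -> 0 <= y' ->
  (x * x') `^ l * (y * y') `^ (1 - l) =
  (x `^ l * y `^ (1 - l)) * (x' `^ l * y' `^ (1 - l)).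
Proof. by move=> x0 x'0 y0 y'0; rewrite !powRM // mulrACA. Qed.

Lemma ler_convex_combination (R : realType) (m a b l : R) :
  0 <= l <= 1 -> m <= a -> m <= b -> m <= l * a + (1 - l) * b.
Proof.
move=> /andP[l0 l1] ma mb.
have -> : m = l * m + (1 - l) * m by ring.
by apply: lerD; apply: ler_wpM2l; rewrite ?subr_ge0.
Qed.

(** The interpolation at fixed arguments: both new constants are built from
    [C1], [C2], [A], [B], [K], [L] and [l] alone, so the bound stays uniform
    when [u], [v], [p], [q] vary as powers of [t]. *)
Lemma log_interpolation (R : realType) (Psi1 Psi2 : R -> R)
    (C1 C2 A B K L u v p q l : R) :
  (forall x, 0 <= x -> 0 <= Psi1 x) -> (forall x, 0 <= x -> 0 <= Psi2 x) ->
  log_convex_upto C1 Psi1 -> log_concave_upto C2 Psi2 ->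
  0 < A -> 0 < B -> 0 < K -> 0 < L -> 0 < u -> 0 < v -> 0 < p -> 0 < q ->
  0 <= l <= 1 ->
  Psi1 u <= A * Psi2 (K * p) -> Psi1 v <= B * Psi2 (L * q) ->
  Psi1 (u `^ l * v `^ (1 - l)) <=
  C1 `^ (l * (1 - l)) * (A `^ l * B `^ (1 - l)) *
  Psi2 (C2 `^ (l * (1 - l)) * (K `^ l * L `^ (1 - l)) *
        (p `^ l * q `^ (1 - l))).
Proof.
move=> Psi1_ge0 Psi2_ge0 conv1 conc2 A0 B0 K0 L0 u0 v0 p0 q0 l01 le_u le_v.
have Kp0 : 0 < K * p by rewrite mulr_gt0.
have Lq0 : 0 < L * q by rewrite mulr_gt0.
apply: (le_trans (conv1 u v l u0 v0 l01)).
rewrite -[leLHS]mulrA -[leRHS]mulrA.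
apply: ler_wpM2l; first exact: powR_ge0.
apply: (@le_trans _ _
  ((A * Psi2 (K * p)) `^ l * (B * Psi2 (L * q)) `^ (1 - l))).
  by apply: ler_geometric_mean; rewrite // Psi1_ge0 // ltW.
have PKp0 := Psi2_ge0 _ (ltW Kp0).
have PLq0 := Psi2_ge0 _ (ltW Lq0).
rewrite (geometric_meanM l (ltW A0) PKp0 (ltW B0) PLq0).
apply: ler_wpM2l; first by rewrite mulr_ge0 ?powR_ge0.
apply: (le_trans (conc2 (K * p) (L * q) l Kp0 Lq0 l01)).
by rewrite -[X in Psi2 X <= _]mulrA
  (geometric_meanM l (ltW K0) (ltW p0) (ltW L0) (ltW q0)) mulrA.
Qed.

Theorem theorem1 (R : realType) (Phi1 Phi2 : R -> R) (C1 C2 : R)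
    (hPhi1 : growth_bijection Phi1) (hC1 : 1 <= C1)
    (hconv : log_convex_upto C1 (growth_inv Phi1))
    (hPhi2 : growth_bijection Phi2) (hC2 : 1 <= C2)
    (hconc : log_concave_upto C2 (growth_inv Phi2)) :
  convex_set (exponent_set Phi1 Phi2).
Proof.
move=> [a1 b1] [a2 b2] lam; rewrite !inE.
move=> [/= a1_ge b1_ge [A [K [A0 K0 bound1]]]].
move=> [/= a2_ge b2_ge [B [L [B0 L0 bound2]]]].
set l : R := lam%:num.
have l01 : 0 <= l <= 1 by rewrite /l ge0 le1.
have C1_gt0 : 0 < C1 by rewrite (lt_le_trans ltr01).
have C2_gt0 : 0 < C2 by rewrite (lt_le_trans ltr01).
split; [exact: ler_convex_combination | exact: ler_convex_combination |].
exists (C1 `^ (l * (1 - l)) * (A `^ l * B `^ (1 - l))).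
exists (C2 `^ (l * (1 - l)) * (K `^ l * L `^ (1 - l))).
split; [by rewrite !mulr_gt0 ?powR_gt0 | by rewrite !mulr_gt0 ?powR_gt0 |].
move=> t t0.
(* The coordinates of the convex combination unfold to those of [powR_affine]. *)
rewrite [X in growth_inv Phi1 X](powR_affine _ _ _ l t0).
rewrite [X in growth_inv Phi2 (_ * X)](powR_affine _ _ _ l t0).
apply: log_interpolation; rewrite ?powR_gt0 //.
- by move=> x; exact: growth_inv_ge0.
- by move=> x; exact: growth_inv_ge0.
- exact: bound1.
- exact: bound2.
Qed.
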